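(* Let $(\mathfrak{H},(\cdot,\cdot)_{\mathfrak{H}})$ and $(\mathfrak{K},(\cdot,\cdot)_{\mathfrak{K}})$ be complex Hilbert spaces and let $T,B:\mathfrak{H}\to\mathfrak{K}$ be closed densely defined linear operators. Let $P_T$ be the orthogonal projection of $\mathfrak{K}$ onto $\overline{\mathrm{ran}}\,T$. Then the following statements are equivalent: (1b) $\mathrm{dom}\,T\subseteq\mathrm{dom}\,B$ and, for some $m>0$, $\|Tf\|_{\mathfrak{K}}^2\ge m\,(Tf,Bf)_{\mathfrak{K}}\ge0$ for all $f\in\mathrm{dom}\,T$; (2b) there exists $Y\in\mathbf{B}^+(\mathfrak{K})$ such that $YT\subseteq P_TB$.
   Context: Operators are linear and possibly unbounded. $\mathbf{B}^+(\mathfrak{K})$ is the set of bounded everywhere defined nonnegative operators on $\mathfrak{K}$. $\overline{\mathrm{ran}}\,T$ is the closure of $\mathrm{ran}\,T$. The inclusion $YT\subseteq P_TB$ is inclusion of graphs: $\mathrm{dom}\,T\subseteq\mathrm{dom}\,B$ and $YTf=P_TBf$ for all $f\in\mathrm{dom}\,T$. An inequality involving $(Tf,Bf)_{\mathfrak{K}}$ includes the claim that the quantities compared are real. *)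

(* Defs.v *)
From HB Require Import structures.
From mathcomp Require Import all_boot all_order all_algebra.
From mathcomp Require Import all_classical all_reals all_analysis.
From mathcomp Require Import complex.
Import Order.TTheory GRing.Theory Num.Theory.
Import numFieldNormedType.Exports.

Set Implicit Arguments.
Unset Strict Implicit.
Unset Printing Implicit Defensive.

Local Open Scope classical_set_scope.
Local Open Scope ring_scope.
Local Open Scope complex_scope.

(* The inner product is linear in its first argument and antilinear in the
   second one. The norm of a normed module over R[i] takes values in R[i]. *)
HB.mixin Record hasInnerProduct (R : realType) V
    of CompleteNormedModule R[i] V := {
  inner : {dot V for (@Num.conj R[i])};
  inner_normE : forall x : V, `|x| ^+ 2 = inner x x }.

#[short(type="hilbertType")]
HB.structure Definition Hilbert (R : realType) :=
  {V of CompleteNormedModule R[i] V & hasInnerProduct R V}.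

Section operators.
Variables (R : realType) (H K : hilbertType R).

(* A possibly unbounded operator; only the values of opfun on dom matter. *)
Record operator := Operator {
  dom : set H;
  opfun :> H -> K;
  dom0 : dom 0;
  dom_lin : forall (a : R[i]) f g, dom f -> dom g -> dom (a *: f + g);
  opfun_lin : forall (a : R[i]) f g, dom f -> dom g ->
    opfun (a *: f + g) = a *: opfun f + opfun g }.

(* Composing an operator on D with an everywhere defined one keeps the domain
   D, so such products are also given as a domain and a function. *)
Definition graph (D : set H) (f : H -> K) : set (H * K) :=
  [set x | D x.1 /\ x.2 = f x.1].

Definition ran (T : operator) : set K := T @` dom T.

Definition closed_op (T : operator) := closed (graph (dom T) T).

Definition densely_defined (T : operator) := dense (dom T).

End operators.

Section projection_and_nonneg.
Variables (R : realType) (K : hilbertType R).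

(* The point y of M such that x - y is orthogonal to M. It exists and is unique
   when M is a closed subspace; the value 0 is a default for other sets M. *)
Definition orthoproj (M : set K) (x : K) : K :=
  xget 0 [set y | M y /\ forall z, M z -> inner (x - y) z = 0].

(* The order of R[i] is such that 0 <= z means that z is real and
   nonnegative. *)
Definition nonneg_op (Y : {linear K -> K}) := forall x, 0 <= inner (Y x) x.

Definition bounded_op (Y : {linear K -> K}) :=
  exists M : R, forall x, `|Y x| <= M%:C * `|x|.

Definition Bplus : set {linear K -> K} :=
  [set Y | bounded_op Y /\ nonneg_op Y].

End projection_and_nonneg.

(* Main.v *)
From HB Require Import structures.
Require Import Defs.
From mathcomp Require Import all_boot all_order all_algebra.
From mathcomp Require Import all_classical all_reals all_analysis.
From mathcomp Require Import complex.
From mathcomp Require Import ring lra.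
Import Order.TTheory GRing.Theory Num.Theory.
Import numFieldNormedType.Exports.

(** If there is Y with YT contained in P_T B, then for f in dom T
      (Tf, Bf) = (Tf, P_T B f) = (Tf, Y T f) = (Y T f, Tf),
    which is nonnegative and at most c |Tf|^2 when c bounds Y, so that
    m = 1 / (|c| + 1) gives the required inequality.

    Conversely, assume |Tf|^2 >= m (Tf, Bf) >= 0 on dom T.  The form
    s(f, g) = (Tf, Bg) is nonnegative on dom T.  It is therefore Hermitian
    ([inner_TB_sym]) and satisfies the Cauchy-Schwarz inequality, which
    together with (Tf, Bf) <= m^-1 |Tf|^2 gives
      |(Tf, Bg)| <= m^-1 |Tf| |Tg|                      ([inner_TB_bound]).
    By continuity |(x, Bg)| <= m^-1 |x| |Tg| for all x in M, the closure of
    ran T.  So for each x in K the functional g |-> (P_T x, Bg) is bounded by a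
    multiple of |Tg|, and there is a unique y in M such that
    (y, Tg) = (P_T x, Bg) for all g in dom T ([repr_TB]).  Put Y x = y.  The map
    Y is linear by uniqueness, bounded by m^-1, and nonnegative, because
    (Y x, x) is a limit of numbers (Tf, Bf) with Tf tending to P_T x
    ([Bplus_repr]).  By the symmetry of s, Y T g = P_T B g.

    This defines Y on the whole of K at once, as a kind of adjoint, so that no
    operator has to be extended from ran T to its closure.  The existence of y,
    like that of the orthogonal projection, is an instance of the
    representation theorem [riesz_ran]: if phi is antilinear on dom T and
    |phi f| <= c |Tf|, then phi f = (y, Tf) for some y in M.  It is proved by
    minimising |Tf|^2 - 2 Re (phi f) over dom T. *)

Local Open Scope classical_set_scope.
Local Open Scope ring_scope.
Local Open Scope complex_scope.

Set Implicit Arguments.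
Unset Strict Implicit.
Unset Printing Implicit Defensive.

(** * Nonnegative sesquilinear forms on a subspace *)

Section nonneg_form.
Variables (R : realType) (V : lmodType R[i]) (D : set V) (s : V -> V -> R[i]).
Hypothesis D_lin : forall (a : R[i]) f g, D f -> D g -> D (a *: f + g).
Hypothesis s_linl : forall (a : R[i]) f g h, D f -> D g -> D h ->
  s (a *: f + g) h = a * s f h + s g h.
Hypothesis s_linr : forall (a : R[i]) f g h, D f -> D g -> D h ->
  s h (a *: f + g) = a^*%C * s h f + s h g.
Hypothesis s_ge0 : forall f, D f -> 0 <= s f f.

Let s_quad (a : R[i]) f g : D f -> D g ->
  s (a *: f + g) (a *: f + g)
  = a * a^*%C * s f f + a * s f g + a^*%C * s g f + s g g.
Proof.
by move=> Df Dg; rewrite s_linl ?s_linr //; [ring|exact: D_lin].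
Qed.

(** Polarization: the values of s on the diagonal at f + g and at i f + g are
    real. *)
Lemma form_conj f g : D f -> D g -> s f g = (s g f)^*%C.
Proof.
move=> Df Dg.
have h1 := ger0_Im (s_ge0 (D_lin 1 Df Dg)).
have h2 := ger0_Im (s_ge0 (D_lin 'i%C Df Dg)).
rewrite s_quad // in h1; rewrite s_quad // in h2.
have hf := ger0_Im (s_ge0 Df); have hg := ger0_Im (s_ge0 Dg).
move: h1 h2 hf hg.
case: (s f g) => p q; case: (s g f) => p' q'.
case: (s f f) => a a'; case: (s g g) => b b' /= h1 h2 hf hg.
by apply/eqP; rewrite eq_complex /=; apply/andP; split; apply/eqP; lra.
Qed.

Lemma form_CauchySchwarz f g : D f -> D g ->
  `|s f g| ^+ 2 <= s f f * s g g.
Proof.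
move=> Df Dg.
have hf := s_ge0 Df; have hg := s_ge0 Dg.
(* Multiplying by s f g makes the coefficient of t the real number
   - 2 |s f g|^2. *)
have h (t : R) := s_ge0 (D_lin (- t%:C * s f g) Dg Df).
have {}h t : 0 <= complex.Re (s f f) - 2 * t * complex.Re (`|s f g| ^+ 2)
   + t ^+ 2 * complex.Re (`|s f g| ^+ 2) * complex.Re (s g g).
  have := h t; rewrite s_quad // (form_conj Dg Df) -add_Re2_Im2.
  have := ger0_Im hf; have := ger0_Im hg.
  case: (s f g) => p q; case: (s f f) => a a'; case: (s g g) => b b' /=.
  move=> -> ->; rewrite lecE /= => /andP[_].
  by move=> /le_trans; apply; nra.
have ab := ger0_Im hf; have bb := ger0_Im hg.
move: h hf hg ab bb; rewrite -add_Re2_Im2.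
set P := _ + _; have P0 : 0 <= P by rewrite addr_ge0 ?sqr_ge0.
case: (s f f) => a a'; case: (s g g) => b b' /= h.
move=> hf hg -> ->; move: hf hg; rewrite !lecE /= => /andP[_ a0] /andP[_ b0].
rewrite !mulr0 mul0r addr0 subr0 eqxx /=.
(* The quadratic inequality h at t = 1 / b, its minimum, gives the claim. If
   b = 0, then h is affine in t and forces P = 0. *)
have [b00|bp] := eqVneq b 0.
  have [->|P1] := eqVneq P 0; first by rewrite mulr_ge0.
  have := h ((a + 1) / (2 * P)); rewrite b00 mulr0 addr0.
  have -> : 2 * ((a + 1) / (2 * P)) * P = a + 1 by field; rewrite P1.
  by lra.
have := h (b^-1).
have -> : a - 2 * b^-1 * P + b^-1 ^+ 2 * P * b = (a * b - P) / b.
  by field; rewrite bp.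
by rewrite pmulr_lge0 ?subr_ge0 // invr_gt0 lt_def bp b0.
Qed.

End nonneg_form.

(** * Inner product and real-valued norm *)

Lemma normc_Re (R : realType) (z : R[i]) : `|z| = (complex.Re `|z|)%:C.
Proof. by rewrite RRe_real // normr_real. Qed.

(** The nonnegative reals are closed in the complex plane. *)
Lemma nonneg_approx (R : realType) (z : R[i]) :
  (forall e : R, 0 < e -> exists2 w, 0 <= w & `|z - w| <= e%:C) -> 0 <= z.
Proof.
move=> h; rewrite lecE /=; apply/andP; split.
  (* The imaginary part is, up to sign, the real part after multiplication
     by i. *)
  rewrite -normr_le0; apply/ler_addgt0Pr => e /h[w w0 zw]; rewrite add0r -lecR.
  have := normc_ge_Re ((z - w) * 'i%C); rewrite ReiNIm normrN normrM.
  rewrite complexiE normCi mulr1 raddfB /= (ger0_Im w0) subr0.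
  by move=> /le_trans; apply.
apply/ler_addgt0Pr => e /h[w w0 zw].
have := le_trans (normc_ge_Re (z - w)) zw; rewrite lecR raddfB /= ler_norml.
by move: w0; rewrite lecE /= => /andP[_ w0] /andP[]; lra.
Qed.

Section inner_product.
Variables (R : realType) (K : hilbertType R).
Implicit Types (x y z : K) (a : R[i]).

Lemma innerC x y : inner x y = Num.conj (inner y x).
Proof.
have := hermC (@inner R K) x y.
by rewrite expr0 mul1r.
Qed.

Lemma innerDl x y z : inner (x + y) z = inner x z + inner y z.
Proof. exact: linearDl. Qed.

Lemma innerBl x y z : inner (x - y) z = inner x z - inner y z.
Proof. exact: linearBl. Qed.

Lemma innerZl a x z : inner (a *: x) z = a * inner x z.
Proof. exact: linearZl_LR. Qed.

Lemma innerDr x y z : inner z (x + y) = inner z x + inner z y.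
Proof. exact: linearDr. Qed.

Lemma innerBr x y z : inner z (x - y) = inner z x - inner z y.
Proof. exact: linearBr. Qed.

Lemma innerZr a x z : inner z (a *: x) = Num.conj a * inner z x.
Proof. exact: linearZr_LR. Qed.

(** The norm as an element of R rather than of R[i], so that arithmetic on norms
    takes place in a totally ordered field. *)
Definition nrm x : R := complex.Re `|x|.

Lemma nrmE x : `|x| = (nrm x)%:C.
Proof. by rewrite /nrm RRe_real // normr_real. Qed.

Lemma nrm_ge0 x : 0 <= nrm x.
Proof. by rewrite -ler0c -nrmE. Qed.

Lemma nrmC x y : nrm (x - y) = nrm (y - x).
Proof. by rewrite /nrm distrC. Qed.

Lemma nrm0_eq0 x : nrm x = 0 -> x = 0.
Proof. by move=> h; apply/eqP; rewrite -normr_eq0 nrmE h. Qed.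

Lemma nrmD x y : nrm (x + y) <= nrm x + nrm y.
Proof. by rewrite -lecR rmorphD /= -!nrmE ler_normD. Qed.

Lemma nrmZ a x : nrm (a *: x) = complex.Re `|a| * nrm x.
Proof.
by apply: complexI; rewrite -nrmE normrZ nrmE rmorphM /= -normc_Re.
Qed.

Lemma innerxx x : inner x x = (nrm x ^+ 2)%:C.
Proof. by rewrite -inner_normE nrmE rmorphXn. Qed.

Lemma inner_norm x y : `|inner x y| <= (nrm x * nrm y)%:C.
Proof.
have h : `|inner x y| ^+ 2 <= inner x x * inner y y.
  apply: (@form_CauchySchwarz _ _ setT (@inner R K)) => //.
  - by move=> a f g h _ _ _; rewrite innerDl innerZl.
  - by move=> a f g h _ _ _; rewrite innerDr innerZr.
rewrite -(@ler_pXn2r R[i] 2 isT) ?nnegrE ?normr_ge0 ?ler0c //; last first.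
  by rewrite mulr_ge0 ?nrm_ge0.
by move: h; rewrite !innerxx !rmorphXn -exprMn -rmorphM.
Qed.

Lemma nrm_sqrZD (x y : K) (t : R) : nrm (t%:C *: y + x) ^+ 2 =
  nrm x ^+ 2 + 2 * t * complex.Re (inner x y) + t ^+ 2 * nrm y ^+ 2.
Proof.
apply: complexI; rewrite -innerxx innerDl !innerDr !innerZl !innerZr.
rewrite (innerC y x) !innerxx.
have -> : Num.conj t%:C = t%:C by exact: conjc_real.
have <- : (inner x y)^*%C = Num.conj (inner x y) by [].
case: (inner x y) => p q; simpc.
by apply/eqP; rewrite eq_complex /=; apply/andP; split; apply/eqP; ring.
Qed.

Lemma closure_nrmP (A : set K) x :
  closure A x <-> forall e : R, 0 < e -> exists2 a, A a & nrm (x - a) < e.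
Proof.
split=> [clA e e0|h B].
  have e0' : 0 < e%:C by rewrite ltcR.
  have [a [Aa]] := clA _ (nbhsx_ballx x e%:C e0').
  rewrite -ball_normE /= nrmE ltcR => ?; by exists a.
rewrite -nbhs_ballE /= => -[e /= e0 eB].
have er : e = (complex.Re e)%:C by rewrite RRe_real // realE ltW.
have [a Aa xa] := h (complex.Re e) ltac:(by rewrite -ltcR -er).
exists a; split=> //; apply: eB; rewrite -ball_normE /= nrmE er ltcR //.
Qed.

End inner_product.

(** * Closures of subspaces *)

Section closure.
Variables (R : realType) (K : hilbertType R).
Implicit Types (A : set K) (x y u : K).

Lemma closure_inner_bound A u (c : R) : 0 <= c ->
  (forall a, A a -> `|inner a u| <= (c * nrm a)%:C) ->
  forall x, closure A x -> `|inner x u| <= (c * nrm x)%:C.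
Proof.
move=> c0 h x /closure_nrmP clx.
rewrite normc_Re lecR; apply/ler_addgt0Pr => e e0.
have k0 : 0 < c + nrm u + 1 by have := nrm_ge0 u; lra.
have [a Aa xa] := clx (e / (c + nrm u + 1)) (divr_gt0 e0 k0).
have {}xa : nrm (x - a) * (c + nrm u + 1) < e by rewrite -ltr_pdivlMr.
have -> : x = (x - a) + a by rewrite subrK.
rewrite innerDl.
have := ler_normD (inner (x - a) u) (inner a u).
have := inner_norm (x - a) u; have := h a Aa.
rewrite [`|inner (x - a) u|]normc_Re [`|inner a u|]normc_Re.
rewrite [`|_ + _|]normc_Re -rmorphD /= !lecR subrK => h1 h2 h3.
have h4 : nrm a <= nrm x + nrm (x - a).
  by have := nrmD x (a - x); rewrite [x + _]addrC subrK nrmC.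
have := nrm_ge0 (x - a); have := nrm_ge0 u.
have : c * nrm a <= c * (nrm x + nrm (x - a)) by rewrite ler_wpM2l.
by nra.
Qed.

Lemma closure_linear A :
  (forall (a : R[i]) x y, A x -> A y -> A (a *: x + y)) ->
  forall (a : R[i]) x y, closure A x -> closure A y -> closure A (a *: x + y).
Proof.
move=> Alin a x y /closure_nrmP clx /closure_nrmP cly.
apply/closure_nrmP => e e0.
have k0 : 0 < complex.Re `|a| + 1.
  by rewrite ltr_wpDl // -ler0c -normc_Re.
have [x' Ax xx] :=
  clx (e / 2 / (complex.Re `|a| + 1)) ltac:(by rewrite !divr_gt0).
have [y' Ay yy] := cly (e / 2) ltac:(by rewrite divr_gt0).
exists (a *: x' + y'); first exact: Alin.
rewrite opprD addrACA -scalerBr.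
apply: le_lt_trans (nrmD _ _) _; rewrite nrmZ.
move: xx; rewrite ltr_pdivlMr // => xx.
by have := nrm_ge0 (x - x'); nra.
Qed.

Lemma closure_orthogonal A u : (forall a, A a -> inner a u = 0) ->
  forall x, closure A x -> inner x u = 0.
Proof.
move=> h x clx; apply/eqP; rewrite -normr_le0.
have := @closure_inner_bound A u 0 (lexx _) _ x clx.
by rewrite !mul0r; apply=> a /h ->; rewrite normr0 mul0r.
Qed.

(** A vector in the closure of a subspace A is determined by its inner products
    with the vectors of A. *)
Lemma closure_inner_eq A y y' :
  (forall (a : R[i]) x y, A x -> A y -> A (a *: x + y)) ->
  closure A y -> closure A y' -> (forall a, A a -> inner y a = inner y' a) ->
  y = y'.
Proof.
move=> Alin cy cy' h; apply/eqP; rewrite -subr_eq0; apply/eqP.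
apply: nrm0_eq0; apply/eqP; rewrite -sqrf_eq0; apply/eqP; apply: complexI.
rewrite -innerxx; apply: (@closure_orthogonal A).
  by move=> a /h e; rewrite innerC innerBl e subrr conjC0.
by rewrite addrC -scaleN1r; exact: closure_linear.
Qed.

End closure.

(** * Representation of functionals bounded by the norm of Tf *)

Section riesz.
Variables (R : realType) (H K : hilbertType R) (T : operator H K).

Lemma ran_lin (a : R[i]) (x y : K) : ran T x -> ran T y -> ran T (a *: x + y).
Proof.
move=> [f df <-] [g dg <-]; exists (a *: f + g); first exact: dom_lin.
by rewrite opfun_lin.
Qed.

Lemma op0 : T 0 = 0.
Proof.
have d0 := dom0 T.
by have := opfun_lin (-1) d0 d0; rewrite scaleN1r addNr scaleN1r addNr.
Qed.

(** The Riesz representation theorem on the closure of ran T, for a functional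
    given on dom T. The bound makes phi f a function of Tf alone. *)
Lemma riesz_ran (phi : H -> R[i]) (c : R) :
  (forall (a : R[i]) f g, dom T f -> dom T g ->
     phi (a *: f + g) = a^*%C * phi f + phi g) ->
  (forall f, dom T f -> `|phi f| <= (c * nrm (T f))%:C) ->
  exists2 y, closure (ran T) y & forall f, dom T f -> inner y (T f) = phi f.
Proof.
move=> phi_lin phi_le.
pose J f := nrm (T f) ^+ 2 - 2 * complex.Re (phi f).
have Jquad (t : R) f k : dom T f -> dom T k -> J (t%:C *: k + f) =
    J f + 2 * t * (complex.Re (inner (T f) (T k)) - complex.Re (phi k))
    + t ^+ 2 * nrm (T k) ^+ 2.
  move=> df dk; rewrite /J opfun_lin // nrm_sqrZD phi_lin // conjc_real.
  by case: (phi f) => p q; case: (phi k) => p' q' /=; ring.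
have Jge f : dom T f -> - c ^+ 2 <= J f.
  move=> /phi_le; rewrite normc_Re lecR /J => h.
  have := normc_ge_Re (phi f); rewrite [X in _ <= X]normc_Re lecR => h'.
  have := ler_norm (complex.Re (phi f)); have := sqr_ge0 (nrm (T f) - c).
  by rewrite sqrrB; lra.
pose S := [set J f | f in dom T].
have Sinf : has_inf S.
  split; first by exists (J 0), 0 => //; exact: dom0.
  by exists (- c ^+ 2) => _ [f df <-]; exact: Jge.
pose d := inf S.
have dle f : dom T f -> d <= J f.
  by move=> df; apply: ge_inf; [case: Sinf | exists f].
have dex (e : R) : 0 < e -> exists2 f, dom T f & J f < d + e.
  by move=> e0; have [_ [f df <-] h] := inf_adherent e0 Sinf; exists f.
(* The images under T of the approximate minimisers of J. *)
pose F : set_system K := filter_from [set e : R | 0 < e]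
  (fun e => T @` [set f | dom T f /\ J f < d + e]).
(* Parallelogram law: compare the values of J at f, g and (f + g) / 2, which all
   lie on the line through f in the direction g - f. *)
have dist f g e : dom T f -> dom T g -> J f < d + e -> J g < d + e ->
    nrm (T f - T g) ^+ 2 <= 4 * e.
  move=> df dg Jf Jg.
  have dk : dom T (-1 *: f + g) by exact: dom_lin.
  have e1 : (1 : R)%:C *: (-1 *: f + g) + f = g.
    by rewrite scale1r scaleN1r addrAC addNr add0r.
  have e2 : T (-1 *: f + g) = T g - T f by rewrite opfun_lin // scaleN1r addrC.
  have h1 := Jquad 1 f _ df dk; have h2 := Jquad (2^-1) f _ df dk.
  have h3 : d <= J ((2^-1 : R)%:C *: (-1 *: f + g) + f).
    by apply: dle; exact: dom_lin.
  rewrite e1 in h1; rewrite h2 in h3.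
  rewrite nrmC -e2; move: h1 h3.
  by set L := _ - complex.Re _ => h1 h3; nra.
have Ffilter : ProperFilter F.
  apply: filter_from_proper; last first.
    by move=> e /= /dex[f df Jf]; exists (T f), f.
  apply: filter_from_filter; first by exists 1 => /=.
  move=> e e' /= e0 e0'; exists (Num.min e e') => /=.
    by rewrite lt_min e0.
  move=> _ [f [df Jf] <-]; split; exists f => //; split=> //.
    by apply: lt_le_trans Jf _; rewrite lerD2l ge_min lexx.
  by apply: lt_le_trans Jf _; rewrite lerD2l ge_min lexx orbT.
have Fcauchy : cauchy F.
  apply: cauchy_exP => e e0.
  have er : e = (complex.Re e)%:C by rewrite RRe_real // realE ltW.
  have e0' : 0 < complex.Re e by rewrite -ltcR -er.
  have k0 : 0 < (complex.Re e) ^+ 2 / 8 by rewrite divr_gt0 ?exprn_gt0.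
  have [f df Jf] := dex _ k0.
  exists (T f), ((complex.Re e) ^+ 2 / 8) => // _ [g [dg Jg] <-].
  rewrite -ball_normE /= nrmE er ltcR.
  have := dist f g _ df dg Jf Jg.
  have := nrm_ge0 (T f - T g); nra.
pose y : K := lim F.
have Fy : F --> y := @cauchy_cvg K F Ffilter Fcauchy.
have near_y (e : R) : 0 < e -> exists2 dl, 0 < dl &
    forall f, dom T f -> J f < d + dl -> nrm (y - T f) < e.
  move=> e0; have e0' : 0 < e%:C by rewrite ltcR.
  have [dl /= dl0 h] := Fy _ (nbhsx_ballx y _ e0').
  exists dl => // f df Jf.
  have : ball y e%:C (T f) by apply: h; exists f.
  by rewrite -ball_normE /= nrmE ltcR.
exists y.
  apply/closure_nrmP => e /near_y[dl dl0 h]; have [f df Jf] := dex _ dl0.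
  by exists (T f); [exists f|exact: h].
(* The derivative of J at y in the direction T g vanishes; J is only defined on
   dom T, so y is replaced by T f for an approximate minimiser f. *)
have Req g : dom T g -> complex.Re (inner y (T g)) = complex.Re (phi g).
  move=> dg; apply/eqP; rewrite -subr_eq0; apply/eqP.
  set w := _ - _.
  have main (t : R) : 0 <= 2 * t * w + t ^+ 2 * nrm (T g) ^+ 2.
    apply/ler_addgt0Pr => e e0.
    have k0 : 0 < 2 * `|t| * nrm (T g) + 1.
      by have := nrm_ge0 (T g); have := normr_ge0 t; nra.
    have [dl dl0 hdl] := near_y _ (divr_gt0 (divr_gt0 e0 (ltr0n _ 2)) k0).
    have m0 : 0 < Num.min dl (e / 2) by rewrite lt_min dl0 divr_gt0.
    have [f df Jf] := dex _ m0.
    have h1 : J f < d + dl.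
      by apply: lt_le_trans Jf _; rewrite lerD2l ge_min lexx.
    have h2 : J f < d + e / 2.
      by apply: lt_le_trans Jf _; rewrite lerD2l ge_min lexx orbT.
    have := hdl f df h1; rewrite ltr_pdivlMr // => h3.
    have := dle _ (dom_lin t%:C dg df); rewrite Jquad //.
    have : 2 * t * (complex.Re (inner (T f) (T g)) - complex.Re (inner y (T g)))
       <= 2 * `|t| * (nrm (y - T f) * nrm (T g)).
      have := inner_norm (T f - y) (T g).
      have := normc_ge_Re (inner (T f - y) (T g)).
      rewrite normc_Re !lecR innerBl raddfB /= [nrm (_ - _)]nrmC => h4 h5.
      have h6 := le_trans h4 h5.
      apply: le_trans (ler_norm _) _; rewrite !normrM normr_nat.
      by rewrite ler_wpM2l // mulr_ge0.
    have := nrm_ge0 (y - T f).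
    rewrite /w; lra.
  (* For w != 0 the quadratic polynomial in main is negative at
     t = - w / (|T g|^2 + 1). *)
  apply/eqP/negP => /negP w0.
  have k0 : 0 < nrm (T g) ^+ 2 + 1 by have := sqr_ge0 (nrm (T g)); lra.
  have := main (- w / (nrm (T g) ^+ 2 + 1)).
  set q := nrm (T g) ^+ 2 in k0 *.
  have -> : 2 * (- w / (q + 1)) * w + (- w / (q + 1)) ^+ 2 * q =
    - (w ^+ 2 * (q + 2) / (q + 1) ^+ 2) by field; rewrite gt_eqF.
  have w2 : 0 < w ^+ 2 by rewrite exprn_even_gt0.
  have q2 : 0 < q + 2 by lra.
  by rewrite oppr_ge0 leNgt divr_gt0 ?(mulr_gt0 w2 q2) ?exprn_gt0.
(* The imaginary parts agree by the equality of the real parts at i g. *)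
move=> g dg; apply/eqP; rewrite eq_complex Req // eqxx /=.
have d0 := dom0 T.
have dig : dom T ('i%C *: g + 0) by exact: dom_lin.
have phi0 : phi 0 = 0.
  apply/eqP; rewrite -normr_le0; have := phi_le 0 d0.
  by rewrite op0 /nrm normr0 /= mulr0.
have := Req _ dig; rewrite opfun_lin // phi_lin // op0 phi0 !addr0 innerZr.
have <- : 'i^*%C = Num.conj ('i%C : R[i]) by [].
by case: (inner y _) => p q; case: (phi g) => p' q'; simpc => /= ->.
Qed.

End riesz.

(** * Orthogonal projection onto the closure of the range *)

Section projection.
Variables (R : realType) (H K : hilbertType R) (T : operator H K).
Implicit Types (x y z : K).
Local Notation M := (closure (ran T)).
Local Notation P := (orthoproj M).

Lemma orthoprojP x : M (P x) /\ forall z, M z -> inner (x - P x) z = 0.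
Proof.
apply: (@xgetPex _ 0 [set y | M y /\ forall z, M z -> inner (x - y) z = 0]).
have [||y My yE] := @riesz_ran _ _ _ T (fun f => inner x (T f)) (nrm x).
- by move=> a f g df dg; rewrite opfun_lin // innerDr innerZr.
- by move=> f _; exact: inner_norm.
exists y; split=> // z Mz; rewrite innerC.
rewrite (closure_orthogonal _ Mz) ?conjC0 // => _ [f df <-].
by rewrite innerC innerBl yE // subrr conjC0.
Qed.

Lemma orthoproj_in x : M (P x).
Proof. by case: (orthoprojP x). Qed.

Lemma orthoproj_innerl x z : M z -> inner (P x) z = inner x z.
Proof.
move=> Mz; apply/eqP; rewrite eq_sym -subr_eq0 -innerBl.
by case: (orthoprojP x) => _ ->.
Qed.

Lemma orthoproj_innerr x z : M z -> inner z (P x) = inner z x.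
Proof. by move=> Mz; rewrite innerC orthoproj_innerl // -innerC. Qed.

Lemma ran_closure f : dom T f -> M (T f).
Proof. by move=> df; apply: subset_closure; exists f. Qed.

Lemma ran_inner_inj x y : M x -> M y ->
  (forall f, dom T f -> inner x (T f) = inner y (T f)) -> x = y.
Proof.
move=> Mx My h; apply: (closure_inner_eq (@ran_lin _ _ _ T) Mx My).
by move=> _ [f df <-]; exact: h.
Qed.

Lemma orthoproj_linear (a : R[i]) x y : P (a *: x + y) = a *: P x + P y.
Proof.
apply: ran_inner_inj; first exact: orthoproj_in.
  by apply: closure_linear; [exact: ran_lin|exact: orthoproj_in..].
move=> f /ran_closure Mf.
by rewrite orthoproj_innerl // !innerDl !innerZl !orthoproj_innerl.
Qed.

Lemma orthoproj_id x : M x -> P x = x.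
Proof.
move=> Mx; apply: ran_inner_inj => //; first exact: orthoproj_in.
by move=> f /ran_closure Mf; rewrite orthoproj_innerl.
Qed.

Lemma nrm_le_inner x (c : R) : 0 <= c ->
  `|inner x x| <= (c * nrm x)%:C -> nrm x <= c.
Proof.
move=> c0; rewrite innerxx ger0_norm ?ler0c ?sqr_ge0 // lecR expr2.
have := nrm_ge0 x; rewrite le_eqVlt => /orP[/eqP <- //|x0].
by rewrite ler_pM2r.
Qed.

Lemma nrm_orthoproj x : nrm (P x) <= nrm x.
Proof.
apply: nrm_le_inner; first exact: nrm_ge0.
by rewrite orthoproj_innerl ?inner_norm //; exact: orthoproj_in.
Qed.

End projection.

(** * The nonnegative operator associated with T and B *)

Section bounded_form.
Variables (R : realType) (H K : hilbertType R) (T B : operator H K) (m : R).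
Hypotheses (TB : dom T `<=` dom B) (m0 : 0 < m).
Hypothesis bnd : forall f, dom T f ->
  `|T f| ^+ 2 >= m%:C * inner (T f) (B f) /\ m%:C * inner (T f) (B f) >= 0.
Local Notation M := (closure (ran T)).
Local Notation P := (orthoproj M).

Let mC0 : 0 < m%:C. Proof. by rewrite ltcR. Qed.

Lemma inner_TB_ge0 f : dom T f -> 0 <= inner (T f) (B f).
Proof. by move=> /bnd[_]; rewrite pmulr_rge0. Qed.

Lemma inner_TB_le f : dom T f ->
  inner (T f) (B f) <= (m^-1 * nrm (T f) ^+ 2)%:C.
Proof.
move=> /bnd[h _]; rewrite mulrC rmorphM fmorphV ler_pdivlMr // mulrC.
by rewrite rmorphXn /= -nrmE.
Qed.

Let D_lin := @dom_lin _ _ _ T.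

Let s_linl (a : R[i]) f g h : dom T f -> dom T g -> dom T h ->
  inner (T (a *: f + g)) (B h) = a * inner (T f) (B h) + inner (T g) (B h).
Proof. by move=> df dg _; rewrite opfun_lin // innerDl innerZl. Qed.

Let s_linr (a : R[i]) f g h : dom T f -> dom T g -> dom T h ->
  inner (T h) (B (a *: f + g)) =
  a^*%C * inner (T h) (B f) + inner (T h) (B g).
Proof.
by move=> /TB df /TB dg _; rewrite opfun_lin // innerDr innerZr.
Qed.

Lemma inner_TB_sym f g : dom T f -> dom T g ->
  inner (T f) (B g) = inner (B f) (T g).
Proof.
move=> df dg; rewrite [RHS]innerC.
exact: (form_conj D_lin s_linl s_linr inner_TB_ge0).
Qed.

Lemma inner_TB_bound f g : dom T f -> dom T g ->
  `|inner (T f) (B g)| <= (m^-1 * nrm (T g) * nrm (T f))%:C.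
Proof.
move=> df dg.
have k0 : 0 <= m^-1 * nrm (T g) * nrm (T f).
  by rewrite !mulr_ge0 ?invr_ge0 ?nrm_ge0 // ltW.
rewrite -(@ler_pXn2r R[i] 2 isT) ?nnegrE ?normr_ge0 ?ler0c //.
apply: le_trans (form_CauchySchwarz D_lin s_linl s_linr inner_TB_ge0 df dg) _.
apply: le_trans (ler_pM (inner_TB_ge0 df) (inner_TB_ge0 dg)
  (inner_TB_le df) (inner_TB_le dg)) _.
by rewrite -rmorphM -rmorphXn lecR; lra.
Qed.

Lemma inner_B_bound x g : M x -> dom T g ->
  `|inner x (B g)| <= (m^-1 * nrm (T g) * nrm x)%:C.
Proof.
move=> Mx dg; apply: (closure_inner_bound _ _ Mx).
  by rewrite mulr_ge0 ?invr_ge0 ?nrm_ge0 // ltW.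
by move=> _ [f df <-]; exact: inner_TB_bound.
Qed.

Lemma repr_TB x : exists2 y, M y &
  forall f, dom T f -> inner y (T f) = inner (P x) (B f).
Proof.
apply: (@riesz_ran _ _ _ T _ (m^-1 * nrm (P x))).
  by move=> a f g /TB df /TB dg; rewrite opfun_lin // innerDr innerZr.
move=> f df; have := inner_B_bound (@orthoproj_in _ _ _ T x) df.
by rewrite -[_ * _ * nrm (T f)]mulrA [nrm (orthoproj _ _) * _]mulrC mulrA.
Qed.

(** In effect, Y is the adjoint of Tf |-> P_T B f, composed with the projection
    onto M. *)
Lemma Bplus_repr : exists2 Y : {linear K -> K}, Bplus Y &
  forall x, M (Y x) /\
    forall f, dom T f -> inner (Y x) (T f) = inner (P x) (B f).
Proof.
have h x : exists y, M y /\
    forall f, dom T f -> inner y (T f) = inner (P x) (B f).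
  by have [y] := repr_TB x; exists y.
have [Y YE] := choice h.
have YM x : M (Y x) by case: (YE x).
have Yinner x f : dom T f -> inner (Y x) (T f) = inner (P x) (B f).
  by case: (YE x) => _; apply.
have Ylin : linear Y.
  move=> a x y; apply: (@ran_inner_inj _ _ _ T) => //.
    by apply: closure_linear => //; exact: ran_lin.
  move=> f df.
  by rewrite innerDl innerZl !Yinner // orthoproj_linear innerDl innerZl.
have Ynrm x : nrm (Y x) <= m^-1 * nrm (P x).
  have k0 : 0 <= m^-1 * nrm (P x) by rewrite mulr_ge0 ?nrm_ge0 ?invr_ge0 ?ltW.
  apply: nrm_le_inner => //; apply: (closure_inner_bound k0 _ (YM x)).
  move=> _ [f df <-]; rewrite innerC norm_conjC Yinner //.
  have := inner_B_bound (@orthoproj_in _ _ _ T x) df.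
  by rewrite -[_ * _ * nrm (T f)]mulrA [nrm (P x) * _]mulrC mulrA.
have Yge0 x : 0 <= inner (Y x) x.
  rewrite -(@orthoproj_innerr _ _ _ T) //; apply: nonneg_approx => e e0.
  (* For Tf at distance d <= 1 from P x, the numbers (Y x, P x) and (Tf, Bf)
     differ by at most k d. *)
  set k := nrm (Y x) + m^-1 * (nrm (P x) + 1) + 1.
  have mV0 : 0 < m^-1 by rewrite invr_gt0.
  have k0 : 0 < k.
    by have := nrm_ge0 (Y x); have := nrm_ge0 (P x); rewrite /k; nra.
  have m1 : 0 < Num.min 1 (e / k) by rewrite lt_min ltr01 divr_gt0.
  have /closure_nrmP /(_ _ m1)[_ [f df <-]] := @orthoproj_in _ _ _ T x.
  rewrite lt_min => /andP[d1]; rewrite ltr_pdivlMr // => de.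
  exists (inner (T f) (B f)); first exact: inner_TB_ge0.
  have -> : inner (Y x) (P x) - inner (T f) (B f) =
     inner (Y x) (P x - T f) + inner (P x - T f) (B f).
    by rewrite innerBr innerBl Yinner // addrA subrK.
  apply: le_trans (ler_normD _ _) _.
  have Md : M (P x - T f).
    rewrite addrC -scaleN1r; apply: closure_linear; first exact: ran_lin.
      exact: ran_closure.
    exact: orthoproj_in.
  apply: le_trans (lerD (inner_norm _ _) (inner_B_bound Md df)) _.
  rewrite -rmorphD lecR.
  have Tfx : nrm (T f) <= nrm (P x) + 1.
    have := nrmD (P x) (T f - P x); rewrite [P x + _]addrC subrK nrmC.
    by move/le_trans; apply; rewrite lerD2l ltW // nrmC.
  have mTfx : m^-1 * nrm (T f) <= m^-1 * (nrm (P x) + 1) by rewrite ler_pM2l.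
  have := nrm_ge0 (P x - T f); move: de; rewrite /k.
  by nra.
pose Yl : {linear K -> K} := HB.pack Y (GRing.isLinear.Build _ _ _ _ Y Ylin).
exists Yl => //; split => //.
exists m^-1 => x; rewrite !nrmE -rmorphM lecR.
by apply: le_trans (Ynrm x) _; rewrite ler_pM2l ?invr_gt0 // nrm_orthoproj.
Qed.

End bounded_form.

(** * The equivalence *)

Theorem theorem3p1 (R : realType) (H K : hilbertType R) (T B : operator H K)
    (Tclosed : closed_op T) (Tdense : densely_defined T)
    (Bclosed : closed_op B) (Bdense : densely_defined B) :
  let P_T := orthoproj (closure (ran T)) in
  (dom T `<=` dom B /\
   exists m : R, 0 < m /\
     forall f, dom T f ->
       `|T f| ^+ 2 >= m%:C * inner (T f) (B f) /\
       m%:C * inner (T f) (B f) >= 0)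
  <->
  (exists Y : {linear K -> K}, Bplus Y /\
     graph (dom T) (Y \o T) `<=` graph (dom B) (P_T \o B)).
Proof.
move=> P; split=> [[TB [m [m0 bnd]]]|[Y [[[c Yc] Y0] YTB]]].
  have [Y Yplus YE] := Bplus_repr TB m0 bnd.
  exists Y; split=> // -[f k] [/= df ->]; split; first exact: TB.
  have [YM Yinner] := YE (T f).
  apply: (@ran_inner_inj _ _ _ T) => //; first exact: orthoproj_in.
  move=> g dg; rewrite Yinner // orthoproj_id; last exact: ran_closure.
  rewrite orthoproj_innerl; last exact: ran_closure.
  exact: (inner_TB_sym TB m0 bnd).
have TB f : dom T f -> dom B f /\ Y (T f) = P (B f).
  by move=> df; exact: (YTB (f, Y (T f)) (conj df erefl)).
split=> [f /TB[] //|].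
(* The bound c need not be positive, hence the absolute value. *)
exists (`|c| + 1)^-1; have c0 : 0 < `|c| + 1 by rewrite ltr_wpDl.
split=> [|f df]; first by rewrite invr_gt0.
have -> : inner (T f) (B f) = inner (Y (T f)) (T f).
  rewrite -(orthoproj_innerr _ (ran_closure df)) -/P.
  have [_ <-] := TB f df.
  (* A nonnegative complex number equals its conjugate. *)
  by rewrite innerC; exact/CrealP/ger0_real.
split; last by rewrite mulr_ge0 // ler0c invr_ge0 ltW.
rewrite fmorphV mulrC ler_pdivrMr ?ltcR //.
apply: le_trans (real_ler_norm (ger0_real (Y0 _))) _.
apply: le_trans (inner_norm _ _) _.
rewrite nrmE -rmorphXn -rmorphM lecR.
have := Yc (T f); rewrite !nrmE -rmorphM lecR => h.
have := ler_norm c; have := nrm_ge0 (T f) => T0 cc.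
by have := ler_wpM2r T0 h; have := ler_wpM2r (sqr_ge0 (nrm (T f))) cc; nra.
Qed.
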